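(* Let $n\ge1$ and $k\ge0$ be integers and let $(\lambda_0\ge\lambda_1\ge\dots\ge\lambda_r>0)$ be a partition of $n$, i.e. $\sum_{i=0}^r\lambda_i=n$. Denote by $V(\lambda)$ the irreducible $S_n$-representation corresponding to this partition, and put $|\lambda|:=n-\lambda_0=\sum_{i\ge1}\lambda_i$. Then $V(\lambda)$ occurs in the $S_n$-module $H^k(PfB_n,\mathbb{Q})$ only if $|\lambda|\ge k$.
   Context: $PfB_n$ (pure flat braid group) is the group generated by symbols $R_{ij}$, $1\le i\ne j\le n$, with relations $R_{ij}R_{ik}R_{jk}=R_{jk}R_{ik}R_{ij}$, $R_{ij}R_{kl}=R_{kl}R_{ij}$ and $R_{ij}R_{ji}=1$ for distinct $i,j,k,l$. $S_n$ acts on $PfB_n$ by $\sigma\cdot R_{ij}=R_{\sigma(i)\sigma(j)}$, and hence on $H^*(PfB_n,\mathbb{Q})$ ($\sigma$ acts as $(\sigma^{-1})^*$). It is known that $H^*(PfB_n,\mathbb{Q})$ is $S_n$-equivariantly isomorphic to the exterior algebra over $\mathbb{Q}$ on degree-1 generators $r_{ij}$, $1\le i\ne j\le n$, with $r_{ij}=-r_{ji}$, modulo the relations $r_{ij}\wedge r_{ik}=r_{ij}\wedge r_{jk}$ and $r_{ik}\wedge r_{jk}=r_{ij}\wedge r_{jk}$ for all $i<j<k$, with $\sigma(r_{ij})=r_{\sigma(i)\sigma(j)}$. Irreducible representations of $S_n$ are indexed by partitions in the usual way, the one-row partition $(n)$ corresponding to the trivial representation. *)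

(* Defs.v *)
From HB Require Import structures.
From mathcomp Require Import all_boot all_order all_algebra all_fingroup.
From mathcomp Require Import generic_quotient ring_quotient.
From mathcomp Require Import boolp functions.

Set Implicit Arguments.
Unset Strict Implicit.
Unset Printing Implicit Defensive.

Import GRing.Theory.
Local Open Scope ring_scope.
Local Open Scope quotient_scope.

Section Subspace.
Variables (V : lmodType rat) (P : submodClosed V).

Record subspace := Subspace { subspace_val : V; _ : subspace_val \in P }.

HB.instance Definition _ := [isSub for subspace_val].
HB.instance Definition _ := [Choice of subspace by <:].
HB.instance Definition _ := [SubChoice_isSubLmodule of subspace by <:].

Lemma subspace_valP a (u v : subspace) : val (a *: u + v) = a *: val u + val v.
Proof. exact: linearP. Qed.

End Subspace.

Section QuotientSpace.
Variables (V : lmodType rat) (P : submodClosed V).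

Definition quot_pred : {pred V} := P.
HB.instance Definition _ := GRing.isZmodClosed.Build V quot_pred
  (GRing.submod_closedB (submodClosedP P)).

Definition qspace := Quotient.quot quot_pred.
HB.instance Definition _ := GRing.Zmodule.on qspace.
Definition qpi (v : V) : qspace := \pi_(Quotient.quot quot_pred) v.

Lemma qpiP (x y : V) : reflect (qpi x = qpi y) (x - y \in P).
Proof. by rewrite -[_ \in P]/(_ \in quot_pred) Quotient.idealrBE; apply: eqP. Qed.

Lemma qpiD : {morph qpi : x y / x + y}.
Proof. by move=> x y; rewrite /qpi /= !piE. Qed.

Lemma qpiK (x : qspace) : qpi (repr x) = x.
Proof. exact: reprK. Qed.

Definition qscale (a : rat) (x : qspace) : qspace := qpi (a *: repr x).

Lemma qpiZ a x : qscale a (qpi x) = qpi (a *: x).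
Proof.
by apply/qpiP; rewrite -scalerBr rpredZ //; apply/qpiP; rewrite qpiK.
Qed.

Fact qscaleA a b x : qscale a (qscale b x) = qscale (a * b) x.
Proof. by rewrite -[x]qpiK !qpiZ scalerA. Qed.
Fact qscale1 : left_id 1 qscale.
Proof. by move=> x; rewrite -[x]qpiK qpiZ scale1r. Qed.
Fact qscaleDr : right_distributive qscale +%R.
Proof.
by move=> a x y; rewrite -[x]qpiK -[y]qpiK -qpiD !qpiZ -qpiD scalerDr.
Qed.
Fact qscaleDl x : {morph qscale^~ x : a b / a + b}.
Proof. by move=> a b; rewrite -[x]qpiK !qpiZ -qpiD scalerDl. Qed.

HB.instance Definition _ :=
  GRing.Zmodule_isLmodule.Build rat qspace qscaleA qscale1 qscaleDr qscaleDl.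

Fact qpi_linear : linear qpi.
Proof. by move=> a x y; rewrite qpiD -qpiZ. Qed.
HB.instance Definition _ := GRing.isLinear.Build rat V qspace *:%R qpi qpi_linear.

Lemma qpi_eq0 x : x \in P -> qpi x = 0.
Proof. by move=> Px; rewrite -(linear0 qpi); apply/qpiP; rewrite subr0. Qed.

End QuotientSpace.

Section Span.
Variables (V : lmodType rat) (S : V -> Prop).

Inductive spanned : V -> Prop :=
| Spanned0 : spanned 0
| SpannedD a v w : S v -> spanned w -> spanned (a *: v + w).

Definition span : {pred V} := fun v => `[< spanned v >].

Lemma spanP v : reflect (spanned v) (v \in span).
Proof. exact: asboolP. Qed.

Fact span_submod_closed : submod_closed span.
Proof.
split=> [|a u v /spanP Su /spanP Sv]; apply/spanP; first exact: Spanned0.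
elim: Su => [|b x w Sx _ IH]; first by rewrite scaler0 add0r.
by rewrite scalerDr scalerA -addrA; apply: SpannedD.
Qed.
HB.instance Definition _ :=
  GRing.isSubmodClosed.Build rat V span span_submod_closed.

Lemma mem_span v : S v -> v \in span.
Proof.
move=> Sv; apply/spanP; rewrite -[v]addr0 -[v in v + _]scale1r.
by apply: SpannedD => //; apply: Spanned0.
Qed.

Lemma span_min (P : submodClosed V) v :
  (forall w, S w -> w \in P) -> v \in span -> v \in P.
Proof.
move=> SP /spanP; elim=> [|a x w /SP Px _ Pw]; first exact: rpred0.
by rewrite rpredD ?rpredZ.
Qed.

End Span.

(* In MathComp (s * t) x = t (s x); hence sn_actM says that this is a left
   action of the symmetric group with its usual composition of maps. *)
Record snModule (n : nat) := SnModule {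
  sn_sort :> lmodType rat;
  sn_act : 'S_n -> sn_sort -> sn_sort;
  sn_act_linear : forall s, linear (sn_act s);
  sn_act1 : forall v, sn_act 1%g v = v;
  sn_actM : forall s t v, sn_act (s * t)%g v = sn_act t (sn_act s v)
}.

Definition sn_equivariant n (M N : snModule n) (f : M -> N) : Prop :=
  forall s v, f (sn_act s v) = sn_act s (f v).

Definition sn_iso n (M N : snModule n) : Prop :=
  exists f : {linear M -> N}, bijective f /\ sn_equivariant f.

Definition occurs_in n (V M : snModule n) : Prop :=
  exists f : {linear V -> M}, injective f /\ sn_equivariant f.

Definition sn_stable n (M : snModule n) (P : {pred M}) : Prop :=
  forall s v, v \in P -> sn_act s v \in P.

Section ActLinear.
Variables (n : nat) (M : snModule n) (s : 'S_n).
HB.instance Definition _ :=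
  GRing.isLinear.Build rat M M *:%R (@sn_act n M s) (@sn_act_linear n M s).

Lemma sn_actD : {morph @sn_act n M s : u v / u + v}.
Proof. exact: linearD. Qed.
Lemma sn_actB : {morph @sn_act n M s : u v / u - v}.
Proof. exact: linearB. Qed.
End ActLinear.

Lemma span_stable n (M : snModule n) (S : M -> Prop) :
  (forall s v, S v -> sn_act s v \in span S) -> sn_stable (span S).
Proof.
move=> stabS s v /spanP; elim=> [|a x w Sx _ IH].
  by rewrite linear0 rpred0.
rewrite linearP; apply: rpredD; last exact: IH.
by apply: rpredZ; apply: stabS.
Qed.

Section SubModule.
Variables (n : nat) (M : snModule n) (P : submodClosed M).
Hypothesis stabP : sn_stable P.

Definition sub_act (s : 'S_n) (v : subspace P) : subspace P :=
  Subspace (stabP s (valP v)).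

Fact sub_act_linear s : linear (sub_act s).
Proof. by move=> a u v; apply: val_inj; rewrite /= !linearP. Qed.
Fact sub_act1 v : sub_act 1%g v = v.
Proof. by apply: val_inj; rewrite /= sn_act1. Qed.
Fact sub_actM s t v : sub_act (s * t)%g v = sub_act t (sub_act s v).
Proof. by apply: val_inj; rewrite /= sn_actM. Qed.

Definition subModule : snModule n := SnModule sub_act_linear sub_act1 sub_actM.

End SubModule.

Section QuotientModule.
Variables (n : nat) (M : snModule n) (P : submodClosed M).
Hypothesis stabP : sn_stable P.

Definition quot_act (s : 'S_n) (x : qspace P) : qspace P :=
  qpi P (sn_act s (repr x)).

Lemma quot_actE s v : quot_act s (qpi P v) = qpi P (sn_act s v).
Proof.
by apply/qpiP; rewrite -linearB; apply: stabP; apply/qpiP; rewrite qpiK.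
Qed.

Fact quot_act_linear s : linear (quot_act s).
Proof.
move=> a x y; rewrite -[x]qpiK -[y]qpiK -linearP !quot_actE.
by rewrite linearP [RHS]/(_ + _) linearP.
Qed.
Fact quot_act1 x : quot_act 1%g x = x.
Proof. by rewrite -[x]qpiK quot_actE sn_act1. Qed.
Fact quot_actM s t x : quot_act (s * t)%g x = quot_act t (quot_act s x).
Proof. by rewrite -[x]qpiK !quot_actE sn_actM. Qed.

Definition quotModule : snModule n :=
  SnModule quot_act_linear quot_act1 quot_actM.

End QuotientModule.

Section FunctionModule.
Variables (n : nat) (X : Type) (a : 'S_n -> X -> X).
Hypothesis a1 : forall x, a 1%g x = x.
Hypothesis aM : forall s t x, a (s * t)%g x = a t (a s x).

Definition fun_act (s : 'S_n) (f : X -> rat^o) : X -> rat^o :=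
  fun x => f (a s^-1%g x).

Fact fun_act_linear s : linear (fun_act s).
Proof. by []. Qed.
Fact fun_act1 f : fun_act 1%g f = f.
Proof. by apply/funext => x; rewrite /fun_act invg1 a1. Qed.
Fact fun_actM s t f : fun_act (s * t)%g f = fun_act t (fun_act s f).
Proof. by apply/funext => x; rewrite /fun_act invMg aM. Qed.

Definition funModule : snModule n := SnModule fun_act_linear fun_act1 fun_actM.

End FunctionModule.

(* The group presented by generators X and relations u = v for Rel u v; the
   letter (x, true) stands for x and (x, false) for its inverse. *)
Section Presentation.
Variables (X : choiceType).
Notation word := (seq (X * bool)).
Variable Rel : word -> word -> Prop.

Definition inv_letter (l : X * bool) := (l.1, ~~ l.2).
Definition inv_word (w : word) : word := rev (map inv_letter w).

Inductive pres_eq : word -> word -> Prop :=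
| PresRefl w : pres_eq w w
| PresSym v w : pres_eq v w -> pres_eq w v
| PresTrans u v w : pres_eq u v -> pres_eq v w -> pres_eq u w
| PresRel u v x y : Rel x y -> pres_eq (u ++ x ++ v) (u ++ y ++ v)
| PresCancel u v l : pres_eq (u ++ [:: l; inv_letter l] ++ v) (u ++ v).

Definition pres_eqb (v w : word) : bool := `[< pres_eq v w >].

Fact pres_eqb_equiv : equiv_class_of pres_eqb.
Proof.
split=> [w|v w|v u w]; first exact/asboolP/PresRefl.
  by apply/asboolP/asboolP; apply: PresSym.
by move=> /asboolP uv /asboolP vw; apply/asboolP; apply: PresTrans uv vw.
Qed.
Canonical pres_equiv := EquivRelPack pres_eqb_equiv.
Canonical pres_encModRel := defaultEncModRel pres_eqb.

Definition presented := {eq_quot pres_eqb}.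
HB.instance Definition _ := Choice.on presented.
Definition pres_class (w : word) : presented := \pi_({eq_quot pres_eqb}) w.

Lemma pres_classP v w : pres_class v = pres_class w <-> pres_eq v w.
Proof.
rewrite /pres_class; split=> [/eqP|vw]; first by rewrite eqmodE => /asboolP.
by apply/eqP; rewrite eqmodE; apply/asboolP.
Qed.

Lemma pres_classK (x : presented) : pres_class (repr x) = x.
Proof. exact: reprK. Qed.

Lemma pres_eq_cat p q v w : pres_eq v w -> pres_eq (p ++ v ++ q) (p ++ w ++ q).
Proof.
elim=> [z|x y _|x y z _ xy _ yz|x y s t st|x y l]; first exact: PresRefl.
- exact: PresSym.
- exact: PresTrans xy yz.
- by rewrite -!catA !(catA p); apply: PresRel.
- by rewrite -!catA !(catA p); apply: PresCancel.
Qed.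

Lemma pres_eqM v v' w w' :
  pres_eq v v' -> pres_eq w w' -> pres_eq (v ++ w) (v' ++ w').
Proof.
move=> /(@pres_eq_cat [::] w) vv' /(@pres_eq_cat v' [::]).
by rewrite !cats0; apply: PresTrans vv'.
Qed.

Lemma inv_letterK : involutive inv_letter.
Proof. by case=> x b; rewrite /inv_letter /= negbK. Qed.

Lemma inv_wordK : involutive inv_word.
Proof.
by move=> w; rewrite /inv_word map_rev revK mapK //; apply: inv_letterK.
Qed.

Lemma pres_eqV w : pres_eq (w ++ inv_word w) [::].
Proof.
elim: w => [|l w IH]; first exact: PresRefl.
rewrite /inv_word /= rev_cons -cats1 -/(inv_word w) catA.
apply: PresTrans (PresCancel [::] [::] l).
by have := pres_eq_cat [:: l] [:: inv_letter l] IH; rewrite -catA.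
Qed.

Definition pres_mul (x y : presented) := pres_class (repr x ++ repr y).
Definition pres_inv (x : presented) := pres_class (inv_word (repr x)).

Lemma pres_repr w : pres_eq (repr (pres_class w)) w.
Proof. by apply/pres_classP; rewrite pres_classK. Qed.

Lemma pres_mulE v w :
  pres_mul (pres_class v) (pres_class w) = pres_class (v ++ w).
Proof. by apply/pres_classP/pres_eqM; apply: pres_repr. Qed.

Fact pres_mulA : associative pres_mul.
Proof.
by move=> x y z; rewrite -[x]pres_classK -[y]pres_classK -[z]pres_classK
  !pres_mulE catA.
Qed.
Fact pres_mul1 : left_id (pres_class [::]) pres_mul.
Proof. by move=> x; rewrite -[x]pres_classK pres_mulE. Qed.
Fact pres_mul1r : right_id (pres_class [::]) pres_mul.
Proof. by move=> x; rewrite -[x]pres_classK pres_mulE cats0. Qed.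
Fact pres_mulV : right_inverse (pres_class [::]) pres_inv pres_mul.
Proof.
move=> x; rewrite -{1}[x]pres_classK pres_mulE.
exact/pres_classP/pres_eqV.
Qed.
Fact pres_mulVl : left_inverse (pres_class [::]) pres_inv pres_mul.
Proof.
move=> x; rewrite -{2}[x]pres_classK pres_mulE; apply/pres_classP.
by rewrite -{2}[repr x]inv_wordK; apply: pres_eqV.
Qed.

HB.instance Definition _ := isGroup.Build presented
  pres_mulA pres_mul1 pres_mul1r pres_mulVl pres_mulV.

End Presentation.

Section PresentationMap.
Variables (X : choiceType) (Rel : seq (X * bool) -> seq (X * bool) -> Prop).

Definition map_word (f : X -> X) : seq (X * bool) -> seq (X * bool) :=
  map (fun l => (f l.1, l.2)).

Definition pres_map (f : X -> X) (x : presented Rel) : presented Rel :=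
  pres_class Rel (map_word f (repr x)).

Section StableMap.
Variable f : X -> X.
Hypothesis f_rel : forall v w, Rel v w -> Rel (map_word f v) (map_word f w).

Lemma pres_mapE w : pres_map f (pres_class Rel w) = pres_class Rel (map_word f w).
Proof.
apply/pres_classP; move: (repr _) (pres_repr Rel w) => v; elim=> {v w}.
- by move=> v; apply: PresRefl.
- by move=> u v _; apply: PresSym.
- by move=> u v z _ uv _; apply: PresTrans uv.
- move=> u v x y xy; rewrite /map_word !map_cat -!/(map_word f _).
  by apply: PresRel; apply: f_rel.
- by move=> u v l; rewrite /map_word !map_cat; apply: PresCancel.
Qed.

Lemma pres_mapM : {morph pres_map f : x y / (x * y)%g}.
Proof.
move=> x y; rewrite -[x]pres_classK -[y]pres_classK [(_ * _)%g]pres_mulE.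
rewrite !pres_mapE [RHS]pres_mulE; congr pres_class; exact: map_cat.
Qed.

End StableMap.
End PresentationMap.

Section PureFlatBraidGroup.
Variable n : nat.

Definition arc := {p : 'I_n * 'I_n | p.1 != p.2}.

Definition mk_arc (i j : 'I_n) (ij : i != j) : arc :=
  exist (fun p : 'I_n * 'I_n => p.1 != p.2) (i, j) ij.

Fact arc_perm_subproof (s : 'S_n) (x : arc) : s (val x).1 != s (val x).2.
Proof. by rewrite (inj_eq perm_inj) (valP x). Qed.

Definition arc_perm (s : 'S_n) (x : arc) : arc := mk_arc (arc_perm_subproof s x).

Lemma arc_perm_mk (s : 'S_n) i j (ij : i != j) (sij : s i != s j) :
  arc_perm s (mk_arc ij) = mk_arc sij.
Proof. exact: val_inj. Qed.

Lemma arc_perm1 x : arc_perm 1%g x = x.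
Proof. by apply: val_inj; rewrite /= !perm1 -surjective_pairing. Qed.

Lemma arc_permM s t x : arc_perm (s * t)%g x = arc_perm t (arc_perm s x).
Proof. by apply: val_inj; rewrite /= !permM. Qed.

Local Notation R h := (mk_arc h, true).

Inductive PfB_rel : seq (arc * bool) -> seq (arc * bool) -> Prop :=
| PfB_YangBaxter i j k (ij : i != j) (ik : i != k) (jk : j != k) :
    PfB_rel [:: R ij; R ik; R jk] [:: R jk; R ik; R ij]
| PfB_commute i j k l (ij : i != j) (kl : k != l) : uniq [:: i; j; k; l] ->
    PfB_rel [:: R ij; R kl] [:: R kl; R ij]
| PfB_flat i j (ij : i != j) (ji : j != i) :
    PfB_rel [:: R ij; R ji] [::].

Definition PfB := presented PfB_rel.
HB.instance Definition _ := Group.on PfB.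

Definition PfB_act (s : 'S_n) : PfB -> PfB := @pres_map _ PfB_rel (arc_perm s).

Lemma PfB_rel_perm s v w :
  PfB_rel v w -> PfB_rel (map_word (arc_perm s) v) (map_word (arc_perm s) w).
Proof.
have neq (a b : 'I_n) : a != b -> s a != s b by rewrite (inj_eq perm_inj).
case=> [i j k ij ik jk|i j k l ij kl u4|i j ij ji].
- rewrite /= (arc_perm_mk ij (neq _ _ ij)) (arc_perm_mk ik (neq _ _ ik)).
  by rewrite (arc_perm_mk jk (neq _ _ jk)); apply: PfB_YangBaxter.
- rewrite /= (arc_perm_mk ij (neq _ _ ij)) (arc_perm_mk kl (neq _ _ kl)).
  by apply: PfB_commute; rewrite -(map_inj_uniq (@perm_inj _ s)) in u4.
- rewrite /= (arc_perm_mk ij (neq _ _ ij)) (arc_perm_mk ji (neq _ _ ji)).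
  exact: PfB_flat.
Qed.

Lemma PfB_actM s : {morph PfB_act s : x y / (x * y)%g}.
Proof. by apply: pres_mapM; apply: PfB_rel_perm. Qed.

Lemma PfB_act_class s w :
  PfB_act s (pres_class PfB_rel w) = pres_class PfB_rel (map_word (arc_perm s) w).
Proof. by apply: pres_mapE; apply: PfB_rel_perm. Qed.

Lemma PfB_act1 x : PfB_act 1%g x = x.
Proof.
rewrite -[x]pres_classK PfB_act_class; congr pres_class.
by rewrite /map_word -[RHS]map_id; apply: eq_map => -[y b] /=; rewrite arc_perm1.
Qed.

Lemma PfB_act_comp s t x : PfB_act (s * t)%g x = PfB_act t (PfB_act s x).
Proof.
rewrite -[x]pres_classK !PfB_act_class; congr pres_class.
by rewrite /map_word -map_comp; apply: eq_map => -[y b] /=; rewrite arc_permM.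
Qed.

End PureFlatBraidGroup.

(* Group cohomology with trivial rational coefficients, computed by homogeneous
   cochains: functions on k.+1-tuples of elements of G that are invariant under
   diagonal left translation by G. *)
Section GroupCohomology.
Variables (G : groupType) (n : nat) (act : 'S_n -> G -> G).
Hypothesis actM : forall s, {morph act s : x y / (x * y)%g}.
Hypothesis act1 : forall x, act 1%g x = x.
Hypothesis act_comp : forall s t x, act (s * t)%g x = act t (act s x).

Definition tuple_act k (s : 'S_n) (g : 'I_k.+1 -> G) : 'I_k.+1 -> G :=
  fun i => act s (g i).

Fact tuple_act1 k (g : 'I_k.+1 -> G) : tuple_act 1%g g = g.
Proof. by apply/funext => i; apply: act1. Qed.
Fact tuple_actM k s t (g : 'I_k.+1 -> G) :
  tuple_act (s * t)%g g = tuple_act t (tuple_act s g).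
Proof. by apply/funext => i; apply: act_comp. Qed.

Definition cochain k : snModule n := funModule (@tuple_act1 k) (@tuple_actM k).

Definition homogeneous k (f : cochain k) : Prop :=
  forall x g, f (fun i => x * g i)%g = f g.

Definition coboundary k (f : cochain k) : cochain k.+1 :=
  fun g => \sum_(i < k.+2) (-1) ^+ i * f (fun j => g (lift i j)).

Definition cocycles k : {pred cochain k} :=
  fun f => `[< homogeneous f /\ coboundary f = 0 >].

Fact coboundary_linear k : linear (@coboundary k).
Proof.
move=> a f h; apply/funext => g.
transitivity (a * coboundary f g + coboundary h g); last by [].
rewrite /coboundary mulr_sumr -big_split; apply: eq_bigr => i _ /=.
by rewrite [(a *: f + h) _]/(a * f _ + h _) mulrDr mulrCA.
Qed.
HB.instance Definition _ k :=
  GRing.isLinear.Build rat (cochain k) (cochain k.+1) *:%R (@coboundary k)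
    (@coboundary_linear k).

Lemma homogeneous0 k : homogeneous (0 : cochain k).
Proof. by []. Qed.

Lemma homogeneousP k a (f h : cochain k) :
  homogeneous f -> homogeneous h -> homogeneous (a *: f + h).
Proof.
move=> Hf Hh x g.
by rewrite [LHS]/(a * f _ + h _) Hf Hh.
Qed.

Lemma homogeneous_act k s (f : cochain k) :
  homogeneous f -> homogeneous (sn_act s f).
Proof.
move=> Hf x g; have E h : sn_act s f h = f (tuple_act s^-1%g h) by [].
rewrite !E -[RHS](Hf (act s^-1%g x)); congr f.
by apply/funext => i; apply: actM.
Qed.

Lemma coboundary_act k s (f : cochain k) :
  coboundary (sn_act s f) = sn_act s (coboundary f).
Proof. by []. Qed.

Fact cocycles_submod_closed k : submod_closed (@cocycles k).
Proof.
split=> [|a f h /asboolP[Hf df] /asboolP[Hh dh]]; apply/asboolP; split.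
- exact: homogeneous0.
- exact: linear0.
- exact: homogeneousP.
- by rewrite linearP /= df dh scaler0 addr0.
Qed.
HB.instance Definition _ k :=
  GRing.isSubmodClosed.Build rat (cochain k) (@cocycles k)
    (@cocycles_submod_closed k).

Fact cocycles_stable k : sn_stable (@cocycles k).
Proof.
move=> s f /asboolP[Hf df]; apply/asboolP; split; first exact: homogeneous_act.
by rewrite coboundary_act df linear0.
Qed.

Definition cocycle_module k : snModule n := subModule (@cocycles_stable k).

Definition coboundaries k : {pred cocycle_module k} :=
  match k with
  | 0 => fun z => `[< val z = 0 >]
  | m.+1 => fun z =>
      `[< exists2 h : cochain m, homogeneous h & val z = coboundary h >]
  end.

Fact coboundaries_submod_closed k : submod_closed (@coboundaries k).
Proof.
case: k => [|k]; split=> [|a z w].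
- exact/asboolP.
- move=> /asboolP z0 /asboolP w0; apply/asboolP.
  by rewrite subspace_valP z0 w0 scaler0 addr0.
- by apply/asboolP; exists 0; [exact: homogeneous0 | rewrite !linear0].
- move=> /asboolP[f Hf zf] /asboolP[h Hh wh]; apply/asboolP.
  exists (a *: f + h); first exact: homogeneousP.
  by rewrite subspace_valP zf wh linearP.
Qed.
HB.instance Definition _ k :=
  GRing.isSubmodClosed.Build rat (cocycle_module k) (@coboundaries k)
    (@coboundaries_submod_closed k).

Fact coboundaries_stable k : sn_stable (@coboundaries k).
Proof.
case: k => [|k] s z.
  move=> /asboolP z0; apply/asboolP.
  by rewrite -[LHS]/(@sn_act n (cochain 0) s (val z)) z0 linear0.
move=> /asboolP[h Hh zh]; apply/asboolP; exists (sn_act s h).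
  exact: homogeneous_act.
by rewrite -[LHS]/(@sn_act n (cochain k.+1) s (val z)) zh.
Qed.

Definition group_cohomology k : snModule n :=
  quotModule (@coboundaries_stable k).

End GroupCohomology.

Definition PfB_cohomology n k : snModule n :=
  group_cohomology (@PfB_actM n) (@PfB_act1 n) (@PfB_act_comp n) k.

(* The degree k component of the graded algebra: noncommutative polynomials of
   degree k in the letters r_ij (rational functions on words of length k),
   modulo the degree k component of the two-sided ideal of relations. *)
Section FlatAlgebra.
Variables (n k : nat).

Definition word_act (s : 'S_n) (w : k.-tuple (arc n)) : k.-tuple (arc n) :=
  map_tuple (arc_perm s) w.

Fact word_act1 w : word_act 1%g w = w.
Proof.
by apply: val_inj; rewrite /= (eq_map (@arc_perm1 n)) map_id.
Qed.
Fact word_actM s t w : word_act (s * t)%g w = word_act t (word_act s w).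
Proof. by apply: val_inj; rewrite /= (eq_map (arc_permM s t)) map_comp. Qed.

Definition tensor_power : snModule n := funModule word_act1 word_actM.

(* The monomial r_w; it is zero when w does not have length k. *)
Definition monomial (w : seq (arc n)) : tensor_power :=
  fun x => (val x == w)%:R.

Local Notation r := mk_arc.

Inductive flat_relator : tensor_power -> Prop :=
| FlatAntisym u v (i j : 'I_n) (ij : i != j) (ji : j != i) :
    flat_relator (monomial (u ++ [:: r ij] ++ v) +
                  monomial (u ++ [:: r ji] ++ v))
| FlatAlternating u v x :
    flat_relator (monomial (u ++ [:: x; x] ++ v))
| FlatAnticomm u v x y :
    flat_relator (monomial (u ++ [:: x; y] ++ v) +
                  monomial (u ++ [:: y; x] ++ v))
| FlatLeft u v (i j l : 'I_n) (ij : i != j) (il : i != l) (jl : j != l) :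
    (i < j < l)%N ->
    flat_relator (monomial (u ++ [:: r ij; r il] ++ v) -
                  monomial (u ++ [:: r ij; r jl] ++ v))
| FlatRight u v (i j l : 'I_n) (ij : i != j) (il : i != l) (jl : j != l) :
    (i < j < l)%N ->
    flat_relator (monomial (u ++ [:: r il; r jl] ++ v) -
                  monomial (u ++ [:: r ij; r jl] ++ v)).

Definition flat_ideal : {pred tensor_power} := span flat_relator.
HB.instance Definition _ := GRing.SubmodClosed.on flat_ideal.

Lemma monomial_act s w : sn_act s (monomial w) = monomial (map (arc_perm s) w).
Proof.
apply/funext => x; congr (_ %:R); congr nat_of_bool.
have K : cancel (@arc_perm n s) (arc_perm s^-1%g).
  by move=> y; rewrite -arc_permM mulgV arc_perm1.
have K' : cancel (@arc_perm n s^-1%g) (arc_perm s).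
  by move=> y; rewrite -arc_permM mulVg arc_perm1.
by rewrite /=; apply/eqP/eqP => [<-|->]; rewrite mapK.
Qed.

(* The stated relations, for i < j < l only, imply the same relations for
   arbitrary distinct i, j, l; this makes the ideal stable under 'S_n. *)
Section Triples.
Variables u v : seq (arc n).
Let q (x y : arc n) := qpi flat_ideal (monomial (u ++ [:: x; y] ++ v)).

Let q_anticomm x y : q x y = - q y x.
Proof.
apply/eqP; rewrite -addr_eq0 -linearD; apply/eqP/qpi_eq0/mem_span.
exact: FlatAnticomm.
Qed.

Let q_antisyml i j (ij : i != j) (ji : j != i) y : q (r ij) y = - q (r ji) y.
Proof.
apply/eqP; rewrite -addr_eq0 -linearD; apply/eqP/qpi_eq0/mem_span.
exact: (FlatAntisym u ([:: y] ++ v)).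
Qed.

Let q_antisymr i j (ij : i != j) (ji : j != i) x : q x (r ij) = - q x (r ji).
Proof. by rewrite q_anticomm (q_antisyml ij ji) -q_anticomm. Qed.

Let rel3 (i j l : 'I_n) :=
  forall (ij : i != j) (il : i != l) (jl : j != l),
    q (r ij) (r il) = q (r ij) (r jl) /\ q (r il) (r jl) = q (r ij) (r jl).

Let rel3_swapl i j l : rel3 i j l -> rel3 j i l.
Proof.
move=> H ji jl il; have ij : i != j by rewrite eq_sym.
have [Hl Hr] := H ij il jl.
rewrite !(q_antisyml ji ij) Hl; split=> //.
by rewrite q_anticomm Hr.
Qed.

Let rel3_swapr i j l : rel3 i j l -> rel3 i l j.
Proof.
move=> H il ij lj; have jl : j != l by rewrite eq_sym.
have [Hl Hr] := H ij il jl.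
rewrite !(q_antisymr lj jl) Hr; split=> //.
by rewrite q_anticomm Hl.
Qed.

Let rel3_lt (i j l : 'I_n) : (i < j < l)%N -> rel3 i j l.
Proof.
by move=> ijl ij il jl; split; apply/qpiP; apply: mem_span;
  [apply: FlatLeft | apply: FlatRight].
Qed.

Lemma flat_rel3 (i j l : 'I_n) (ij : i != j) (il : i != l) (jl : j != l) :
    qpi flat_ideal (monomial (u ++ [:: r ij; r il] ++ v)) =
      qpi flat_ideal (monomial (u ++ [:: r ij; r jl] ++ v)) /\
    qpi flat_ideal (monomial (u ++ [:: r il; r jl] ++ v)) =
      qpi flat_ideal (monomial (u ++ [:: r ij; r jl] ++ v)).
Proof.
suff: rel3 i j l by apply.
have := ij; have := il; have := jl; rewrite !neq_ltn.
case/orP=> jl' /orP[] il' /orP[] ij'.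
- by apply: rel3_lt; rewrite ij' jl'.
- by apply: rel3_swapl; apply: rel3_lt; rewrite ij' il'.
- by have := ltn_trans il' (ltn_trans ij' jl'); rewrite ltnn.
- by apply/rel3_swapl/rel3_swapr/rel3_lt; rewrite il' jl'.
- by apply/rel3_swapr/rel3_lt; rewrite il' jl'.
- by have := ltn_trans il' (ltn_trans jl' ij'); rewrite ltnn.
- by apply/rel3_swapr/rel3_swapl/rel3_lt; rewrite il' ij'.
- by apply/rel3_swapl/rel3_swapr/rel3_swapl/rel3_lt; rewrite ij' jl'.
Qed.

End Triples.

Fact flat_ideal_stable : sn_stable flat_ideal.
Proof.
apply: span_stable => s f.
have neq (a b : 'I_n) : a != b -> s a != s b by rewrite (inj_eq perm_inj).
case=> [u v i j ij ji|u v x|u v x y|u v i j l ij il jl _|u v i j l ij il jl _].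
- rewrite sn_actD !monomial_act !map_cat /=; apply: mem_span.
  rewrite (arc_perm_mk ij (neq _ _ ij)) (arc_perm_mk ji (neq _ _ ji)).
  exact: FlatAntisym.
- rewrite monomial_act !map_cat; apply: mem_span; exact: FlatAlternating.
- rewrite sn_actD !monomial_act !map_cat; apply: mem_span; exact: FlatAnticomm.
- rewrite sn_actB !monomial_act !map_cat /=.
  rewrite (arc_perm_mk ij (neq _ _ ij)) (arc_perm_mk il (neq _ _ il)).
  rewrite (arc_perm_mk jl (neq _ _ jl)).
  by apply/qpiP; apply: (flat_rel3 _ _ _ _ _).1.
- rewrite sn_actB !monomial_act !map_cat /=.
  rewrite (arc_perm_mk ij (neq _ _ ij)) (arc_perm_mk il (neq _ _ il)).
  rewrite (arc_perm_mk jl (neq _ _ jl)).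
  by apply/qpiP; apply: (flat_rel3 _ _ _ _ _).2.
Qed.

Definition flat_algebra : snModule n := quotModule flat_ideal_stable.

End FlatAlgebra.

Definition is_partition (n : nat) (lam : seq nat) : bool :=
  [&& sorted geq lam, all (leq 1) lam & sumn lam == n].

(* The tableau of shape lam used below is filled row by row with 0, ..., n - 1:
   reshape_index lam i and reshape_offset lam i are the row and the column of
   the cell containing i. *)
Section SpechtModule.
Variables (n : nat) (lam : seq nat).

Definition row_group : {set 'S_n} :=
  [set p : 'S_n | [forall i : 'I_n,
     reshape_index lam (p i) == reshape_index lam i]].

Definition col_group : {set 'S_n} :=
  [set p : 'S_n | [forall i : 'I_n,
     reshape_offset lam (p i) == reshape_offset lam i]].

(* Left translation: since (t * s) x = s (t x), t * s is "s after t". *)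
Definition left_mul (s t : 'S_n) : 'S_n := (t * s)%g.

Fact left_mul1 t : left_mul 1%g t = t.
Proof. exact: mulg1. Qed.
Fact left_mulM s t x : left_mul (s * t)%g x = left_mul t (left_mul s x).
Proof. exact: mulgA. Qed.

(* The group algebra Q[S_n]; f is the element \sum_t f(t) t. *)
Definition group_algebra : snModule n := funModule left_mul1 left_mulM.

(* c = (\sum_p p) (\sum_q sgn(q) q), p in the row group, q in the column
   group. *)
Definition young_symmetrizer : group_algebra :=
  fun t => \sum_(p in row_group) \sum_(q in col_group | left_mul p q == t)
    (-1) ^+ q.

Definition specht_ideal : {pred group_algebra} :=
  span (fun f => exists s, f = sn_act s young_symmetrizer).
HB.instance Definition _ := GRing.SubmodClosed.on specht_ideal.

Fact specht_ideal_stable : sn_stable specht_ideal.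
Proof.
apply: span_stable => s f [t ->]; apply: mem_span.
by exists (t * s)%g; rewrite sn_actM.
Qed.

Definition specht : snModule n := subModule specht_ideal_stable.

End SpechtModule.

(* Main.v *)
(** Up to sign, a nonzero monomial r_w depends only on the components of the
    graph of w: the transposition of two vertices of one component negates it.
    Since an edge inside a component kills the monomial, a nonzero monomial of
    degree k has a graph with at most n - k components. The Young symmetrizer
    gives a nonzero vector of H^k invariant under the permutations of the first
    lambda_0 letters; if lambda_0 > n - k, two of these letters lie in one
    component of every nonzero monomial, so averaging over the row group kills
    all monomials, hence that vector. *)
Require Import Defs.
From HB Require Import structures.
From mathcomp Require Import all_boot all_order all_algebra all_fingroup.
From mathcomp Require Import boolp functions.

Set Implicit Arguments.
Unset Strict Implicit.
Unset Printing Implicit Defensive.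

Import GRing.Theory Num.Theory.
Local Open Scope ring_scope.

Lemma self_opp_eq0 (V : lmodType rat) (v : V) : v = - v -> v = 0.
Proof.
move/eqP; rewrite -addr_eq0 -mulr2n -scaler_nat scaler_eq0 pnatr_eq0 /=.
by move/eqP.
Qed.

Lemma sn_actN n (M : snModule n) s (v : M) : sn_act s (- v) = - sn_act s v.
Proof. exact: linearN. Qed.

Lemma sn_act_sum n (M : snModule n) s (I : finType) (P : pred I) (F : I -> M) :
  sn_act s (\sum_(i | P i) F i) = \sum_(i | P i) sn_act s (F i).
Proof. exact: linear_sum. Qed.

(** Reindexing by [p -> t * p] shows that the sum is its own opposite, hence 0 over the
    rationals. *)
Lemma sum_act_eq0 n (M : snModule n) (H : {set 'S_n}) t (v : M) :
    (forall p, (t * p \in H)%g = (p \in H)) -> sn_act t v = - v ->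
  \sum_(p in H) sn_act p v = 0.
Proof.
move=> tH tv; apply: self_opp_eq0; rewrite {1}(reindex_inj (mulgI t)) /=.
rewrite (eq_bigl _ _ tH) -sumrN; apply: eq_bigr => p _.
by rewrite sn_actM tv sn_actN.
Qed.

(** * Monomials of the flat algebra and their sign rules *)

Section FlatMonomials.
Variables n k : nat.
Implicit Types (i j l : 'I_n) (x y : Defs.arc n) (p u v w : seq (Defs.arc n)).

Definition flat_monomial w : flat_algebra n k :=
  qpi (@flat_ideal n k) (monomial w).
Local Notation q := flat_monomial.
Local Notation r := mk_arc.

Lemma flat_monomial_act s w : sn_act s (q w) = q (map (arc_perm s) w).
Proof.
by rewrite /flat_monomial -monomial_act; apply: (quot_actE (@flat_ideal_stable n k)).
Qed.

Lemma flat_monomial_size w : size w != k -> q w = 0.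
Proof.
move=> szw; rewrite /flat_monomial (_ : @monomial n k w = 0) ?linear0 //.
apply/funext => t; rewrite /monomial; case: eqP => // tw.
by rewrite -tw size_tuple eqxx in szw.
Qed.

Lemma flat_monomial_antisym u v i j (ij : i != j) (ji : j != i) :
  q (u ++ r ij :: v) = - q (u ++ r ji :: v).
Proof.
apply/eqP; rewrite -addr_eq0 -linearD; apply/eqP/qpi_eq0/mem_span.
exact: FlatAntisym.
Qed.

Lemma flat_monomial_anticomm u v x y :
  q (u ++ [:: x, y & v]) = - q (u ++ [:: y, x & v]).
Proof.
apply/eqP; rewrite -addr_eq0 -linearD; apply/eqP/qpi_eq0/mem_span.
exact: FlatAnticomm.
Qed.

Lemma flat_monomial_sqr u v x : q (u ++ [:: x, x & v]) = 0.
Proof. by apply: self_opp_eq0; apply: flat_monomial_anticomm. Qed.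

Lemma flat_monomial_share u v i j l (ij : i != j) (il : i != l) (jl : j != l) :
  q (u ++ [:: r ij, r il & v]) = q (u ++ [:: r ij, r jl & v]).
Proof. exact: (flat_rel3 k u v ij il jl).1. Qed.

Lemma flat_monomial_move u v w x :
  q (u ++ v ++ x :: w) = (-1) ^+ size v *: q (u ++ x :: v ++ w).
Proof.
elim: v u => [|y v IH] u; first by rewrite scale1r.
rewrite /= -cat_rcons IH cat_rcons flat_monomial_anticomm exprS -scalerA.
by rewrite scaleN1r scalerN.
Qed.

(** * Transposing the endpoints of an edge *)

Lemma arc_perm_mkE (s : 'S_n) i j (ij : i != j) :
  exists sij : s i != s j, arc_perm s (r ij) = r sij.
Proof.
have sij : s i != s j by rewrite (inj_eq perm_inj).
by exists sij; apply: arc_perm_mk.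
Qed.

(** If [y] shares one vertex with [r ij], this is the relation r_ij r_il = r_ij r_jl up to
    orientation; if it shares both, both sides vanish; if none, [y] is fixed. *)
Lemma flat_monomial_tperm_next u v i j (ij : i != j) y :
  q (u ++ [:: r ij, arc_perm (tperm i j) y & v]) = q (u ++ [:: r ij, y & v]).
Proof.
have ji : j != i by rewrite eq_sym.
have flip z a b (ab : a != b) (ba : b != a) :
    q (u ++ [:: z, r ab & v]) = - q (u ++ [:: z, r ba & v]).
  by have := flat_monomial_antisym (rcons u z) v ab ba; rewrite !cat_rcons.
have zero : q (u ++ [:: r ij, r ji & v]) = 0.
  by rewrite (flip _ _ _ _ ij) flat_monomial_sqr oppr0.
have mkE (a b : 'I_n) (ab ab' : a != b) : r ab = r ab' by apply: val_inj.
case: y => -[a b] /= ab; rewrite -[exist _ _ _]/(r ab).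
have [sab ->] := arc_perm_mkE (tperm i j) ab.
have [ai|ai] := eqVneq a i.
  subst a; have [bj|bj] := eqVneq b j.
    subst b; rewrite (mkE _ _ ab ij) flat_monomial_sqr -[RHS]zero.
    by move: sab; rewrite tpermL tpermR => sab; rewrite (mkE _ _ sab ji).
  move: sab; rewrite tpermL tpermD // 1?eq_sym // => sab.
  by rewrite -(flat_monomial_share _ _ ij ab sab).
have [aj|aj] := eqVneq a j.
  subst a; have [bi|bi] := eqVneq b i.
    subst b; rewrite (mkE _ _ ab ji) zero.
    move: sab; rewrite tpermL tpermR => sab.
    by rewrite (mkE _ _ sab ij) flat_monomial_sqr.
  move: sab; rewrite tpermR tpermD // 1?eq_sym // => sab.
  by rewrite (flat_monomial_share _ _ ij sab ab).
have ia : i != a by rewrite eq_sym.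
have ja : j != a by rewrite eq_sym.
have [bi|bi] := eqVneq b i.
  subst b; move: sab; rewrite tpermL tpermD // => sab.
  by rewrite (flip _ _ _ sab ja) (flip _ _ _ ab ia) -flat_monomial_share.
have [bj|bj] := eqVneq b j.
  subst b; move: sab; rewrite tpermR tpermD // => sab.
  by rewrite (flip _ _ _ ab ja) (flip _ _ _ sab ia) -flat_monomial_share.
move: sab; rewrite !tpermD // 1?eq_sym // => sab.
by rewrite (mkE _ _ sab ab).
Qed.

(** Each letter is transposed back while adjacent to [r ij], which then anticommutes past it at the
    cost of the same sign on both sides. *)
Lemma flat_monomial_tperm_tail u v i j (ij : i != j) :
  q (u ++ r ij :: map (arc_perm (tperm i j)) v) = q (u ++ r ij :: v).
Proof.
elim: v u => //= y v IH u.
rewrite flat_monomial_tperm_next !(flat_monomial_anticomm _ _ (r ij)).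
by rewrite -cat_rcons IH cat_rcons.
Qed.

(* Quantifying over prefixes p makes this a statement on w in the whole algebra
   rather than in degree k only. *)
Definition tperm_negates w i j : Prop :=
  i = j \/ forall p, q (p ++ map (arc_perm (tperm i j)) w) = - q (p ++ w).

Lemma tperm_negates_sym w i j : tperm_negates w i j -> tperm_negates w j i.
Proof. by case=> [->|H]; [left | right; rewrite tpermC]. Qed.

Lemma tperm_negates_trans w i j l :
  tperm_negates w i j -> tperm_negates w j l -> tperm_negates w i l.
Proof.
case=> [->//|Hij] [<-|Hjl]; first by right.
have [->|il] := eqVneq i l; first by left.
have [ij|ij] := eqVneq i j; first by rewrite ij; right.
have [jl|jl] := eqVneq j l; first by rewrite -jl; right.
right=> p; pose s := tperm i j; pose t := tperm j l.
have apK a b : map (arc_perm (tperm a b)) (map (arc_perm (tperm a b)) p) = p.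
  by rewrite -map_comp -[RHS]map_id; apply: eq_map => y /=;
    rewrite -arc_permM tperm2 arc_perm1.
(* Transposing a suffix alone amounts to transposing the prefix and then the whole monomial; the
   changed prefix is why all prefixes are allowed. *)
have act2 a b u v : q (u ++ map (arc_perm (tperm a b)) v) =
    sn_act (tperm a b) (q (map (arc_perm (tperm a b)) u ++ v)).
  rewrite flat_monomial_act map_cat; congr (q (_ ++ _)).
  by rewrite -map_comp -[LHS]map_id; apply: eq_map => y /=;
    rewrite -arc_permM tperm2 arc_perm1.
(* (i l) is (j l) conjugated by (i j), so three sign changes leave one. *)
have E : map (arc_perm (tperm i l)) w =
    map (arc_perm s) (map (arc_perm t) (map (arc_perm s) w)).
  rewrite -!map_comp; apply: eq_map => y /=; rewrite -!arc_permM.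
  congr (arc_perm _ y); rewrite /s /t.
  by have := tpermJ j l s; rewrite tpermR (tpermD il jl) conjgE tpermV mulgA.
rewrite E act2 act2 Hij !sn_actN -act2 Hjl sn_actN opprK -act2.
exact: Hij.
Qed.

(** The sign comes from reversing [x] itself; with [x] as a factor, transposing the other letters
    changes nothing. *)
Lemma tperm_negates_edge w x : x \in w -> tperm_negates w (val x).1 (val x).2.
Proof.
case: x => -[i j] /= ij; rewrite -[exist _ _ _]/(r ij) => /splitPr[u v].
right=> p; rewrite map_cat /=.
have ji : j != i by rewrite eq_sym.
have -> : arc_perm (tperm i j) (r ij) = r ji.
  by apply: val_inj; rewrite /= tpermL tpermR.
rewrite catA (flat_monomial_antisym _ _ ji ij) -catA; congr (- _).
by rewrite !flat_monomial_move size_map -map_cat flat_monomial_tperm_tail.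
Qed.

(** Transposing the endpoints of [x] in [w] preserves the monomial because [x] is a factor, yet
    negates it by hypothesis. *)
Lemma flat_monomial_cycle p x w :
  tperm_negates w (val x).1 (val x).2 -> q (p ++ x :: w) = 0.
Proof.
case: x => -[i j] /= ij; rewrite -[exist _ _ _]/(r ij).
case=> [eij|H]; first by case/eqP: (ij).
apply: self_opp_eq0; rewrite -cat_rcons -H !cat_rcons.
by rewrite flat_monomial_tperm_tail.
Qed.

(** * Components of the graph of a monomial *)

(* Labels the vertices of the graph with edge list w by its components. *)
Definition component w : 'I_n -> 'I_n :=
  foldr (fun x c a => if c a == c (val x).2 then c (val x).1 else c a) id w.

(** Induction on the edges: a new edge [x] merges only the classes of its two endpoints, and [E]
    relates these. *)
Lemma component_connected (E : 'I_n -> 'I_n -> Prop) w a b :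
    (forall i, E i i) -> (forall i j, E i j -> E j i) ->
    (forall i j l, E i j -> E j l -> E i l) ->
    (forall x, x \in w -> E (val x).1 (val x).2) ->
  component w a = component w b -> E a b.
Proof.
move=> Er Es Et; elim: w a b => [|x w IH] a b Ew /=; first by move=> ->.
have Ex := Ew x (mem_head _ _).
have {}IH a' b' : component w a' = component w b' -> E a' b'.
  by apply: IH => y yw; apply: Ew; rewrite inE yw orbT.
case: eqP => [/IH aj|_]; case: eqP => [/IH bj|_].
- by move=> _; apply: Et aj (Es _ _ bj).
- by move=> /IH ib; apply: Et aj (Et _ _ _ (Es _ _ Ex) ib).
- by move=> /IH ai; apply: Et ai (Et _ _ _ Ex (Es _ _ bj)).
- exact: IH.
Qed.

Lemma component_negates w a b :
  component w a = component w b -> tperm_negates w a b.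
Proof.
apply: component_connected => [i|i j|i j l|x].
- by left.
- exact: tperm_negates_sym.
- exact: tperm_negates_trans.
- exact: tperm_negates_edge.
Qed.

(** The graph of a nonzero monomial is a forest: each edge joins two distinct components of the
    edges after it, so it lowers the number of labels. *)
Lemma card_component p w : q (p ++ w) != 0 ->
  (#|[set component w a | a in 'I_n]| + size w <= n)%N.
Proof.
elim: w p => [|x w IH] p nz.
  by rewrite addn0 -[leqRHS]card_ord; apply: max_card.
(* The head letter joins the prefix, so the induction hypothesis concerns the same nonzero
   monomial. *)
have := nz; rewrite -cat_rcons => /IH; apply: leq_trans.
rewrite /= addnS -addSn leq_add2r; set c := component w.
have cx : c (val x).1 != c (val x).2.
  by apply: contra nz => /eqP/component_negates/flat_monomial_cycle ->.
(* The label [c (val x).2] is merged away and no new label appears. *)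
rewrite [X in (_ < X)%N](cardsD1 (c (val x).2)) imset_f // add1n ltnS.
apply/subset_leq_card/subsetP => _ /imsetP[a _ ->]; rewrite 2!inE.
by case: ifPn => [_|->]; rewrite ?cx imset_f.
Qed.

Lemma flat_monomial_sum_eq0 w m (H : {set 'S_n}) :
    (forall a b : 'I_n, a < m -> b < m ->
      forall s : 'S_n, (tperm a b * s \in H)%g = (s \in H))%N ->
    (m <= n)%N -> (n < m + k)%N ->
  \sum_(s in H) sn_act s (q w) = 0.
Proof.
move=> tH le_mn lt_nm.
have [->|nz] := eqVneq (q w) 0; first by apply: big1 => p _; rewrite linear0.
have szw : size w = k.
  by apply/eqP; apply: contraNT nz => /flat_monomial_size ->.
have := @card_component [::] w nz; rewrite szw => le_comp.
pose f (a : 'I_m) := component w (widen_ord le_mn a).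
(* Pigeonhole: the labels number at most n - k, fewer than [m]. *)
have /injectivePn[a [b ab fab]] : ~~ injectiveb f.
  apply: contraL lt_nm => /injectiveP/card_imset f_inj; rewrite -leqNgt.
  apply: leq_trans le_comp; rewrite leq_add2r -[leqLHS]card_ord -f_inj.
  apply/subset_leq_card/subsetP => _ /imsetP[a _ ->]; exact: imset_f.
have [/(congr1 val)/= eab|neg] := component_negates fab.
  by case/eqP: ab; apply: val_inj.
apply: (sum_act_eq0 (t := tperm (widen_ord le_mn a) (widen_ord le_mn b))).
  by apply: tH => /=; apply: ltn_ord.
by rewrite flat_monomial_act; apply: (neg [::]).
Qed.

Lemma flat_monomial_span (v : flat_algebra n k) :
  exists c : k.-tuple (Defs.arc n) -> rat, v = \sum_t c t *: q t.
Proof.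
have [g <-] : exists g, qpi (@flat_ideal n k) g = v by eexists; apply: qpiK.
exists g.
have {1}-> : g = \sum_t g t *: monomial t.
  apply/funext => t; rewrite fct_sumE (bigD1 t) //= big1 => [|u ut]; last first.
    rewrite [LHS]/(_ * _) /monomial (inj_eq val_inj) eq_sym (negPf ut).
    exact: mulr0.
  by rewrite addr0 [RHS]/(_ * _) /monomial eqxx [RHS]mulr1.
by rewrite linear_sum; apply: eq_bigr => t _; rewrite linearZ.
Qed.

End FlatMonomials.

(** * A row-invariant vector in the Specht module *)

Section RowInvariant.
Variables (n : nat) (lam : seq nat).

Lemma row_group_act p i :
  p \in row_group n lam -> reshape_index lam (p i) = reshape_index lam i.
Proof. by rewrite inE => /forallP/(_ i)/eqP. Qed.

Lemma row_groupMl s p :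
  s \in row_group n lam -> (s * p \in row_group n lam)%g = (p \in row_group n lam).
Proof.
move=> Rs; rewrite !inE; apply/forallP/forallP => H i.
  by have := H (s^-1%g i); rewrite permM -(row_group_act (s^-1%g i) Rs) permKV.
by rewrite permM (eqP (H _)) (row_group_act _ Rs).
Qed.

Lemma row_groupMr s p :
  s \in row_group n lam -> (p * s \in row_group n lam)%g = (p \in row_group n lam).
Proof.
by move=> Rs; rewrite !inE; apply: eq_forallb => i;
  rewrite permM (row_group_act _ Rs).
Qed.

Lemma row_group_tperm (a b : 'I_n) : (a < nth 0 lam 0)%N ->
  (b < nth 0 lam 0)%N -> tperm a b \in row_group n lam.
Proof.
move=> al bl; rewrite inE; apply/forallP => i.
have row0 c : (c < nth 0 lam 0)%N -> reshape_index lam c = 0%N.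
  by move=> cl; have := flatten_indexKl cl; rewrite /flatten_index take0.
by case: tpermP => [->|->|//]; rewrite !row0.
Qed.

(** Left multiplication by [s] only permutes the row sum, the left factor of the symmetrizer. *)
Lemma young_symmetrizer_row s : s \in row_group n lam ->
  sn_act s (@young_symmetrizer n lam) = @young_symmetrizer n lam.
Proof.
move=> Rs; apply/funext => t.
rewrite [LHS]/(@young_symmetrizer n lam (t * s^-1)%g) /young_symmetrizer.
rewrite [RHS](reindex_inj (mulIg s)) /=.
apply: eq_big => [p|p _]; first by rewrite row_groupMr.
apply: eq_bigl => u; congr (_ && _); rewrite /left_mul mulgA.
by apply/eqP/eqP => [->|<-]; rewrite ?mulgKV ?mulgK.
Qed.

(** Shows that the symmetrizer is nonzero: row and column groups meet only in 1, so a single pair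
    contributes. *)
Lemma young_symmetrizer1 : @young_symmetrizer n lam 1%g = 1.
Proof.
have R1 : 1%g \in row_group n lam by rewrite inE; apply/forallP=> i; rewrite perm1.
have C1 : 1%g \in col_group n lam by rewrite inE; apply/forallP=> i; rewrite perm1.
have only1 p u : p \in row_group n lam -> u \in col_group n lam ->
    left_mul p u = 1%g -> u = 1%g.
  rewrite /left_mul => Rp Cu up; apply/permP => i; rewrite perm1.
  (* A cell is determined by its row and column: [u] keeps columns, and it keeps rows since [p]
     undoes it while preserving rows. *)
  apply: ord_inj; rewrite -[LHS](reshape_indexK lam) -[RHS](reshape_indexK lam).
  rewrite -(row_group_act (u i) Rp) -permM up perm1.
  by move: Cu; rewrite inE => /forallP/(_ i)/eqP ->.
rewrite /young_symmetrizer (bigD1 1%g) //= (bigD1 1%g) /=; last first.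
  by rewrite C1 /left_mul mulg1 eqxx.
rewrite odd_perm1 expr0 big1 => [|u /andP[/andP[Cu /eqP e] u1]]; last first.
  by rewrite (only1 _ _ R1 Cu e) eqxx in u1.
rewrite big1 ?addr0 // => p /andP[Rp p1]; apply: big1 => u /andP[Cu /eqP e].
by case/eqP: p1; move: (e); rewrite (only1 _ _ Rp Cu e) /left_mul mul1g.
Qed.

Lemma specht_row_invariant : exists2 c : specht n lam,
  c != 0 & forall s, s \in row_group n lam -> sn_act s c = c.
Proof.
have Yin : @young_symmetrizer n lam \in specht_ideal (n := n) lam.
  by apply: mem_span; exists 1%g; rewrite sn_act1.
exists (Subspace Yin) => [|s Rs].
  apply/eqP => /(congr1 val)/= /(congr1 (fun f => f 1%g)).
  by rewrite young_symmetrizer1 => /eqP; rewrite oner_eq0.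
by apply: val_inj; apply: young_symmetrizer_row.
Qed.

End RowInvariant.

(* The hypothesis is the known equivariant description of the cohomology. *)
Theorem theorem12 (n k : nat) (lam : seq nat) (n_gt0 : (0 < n)%N)
  (known_presentation : sn_iso (PfB_cohomology n k) (flat_algebra n k))
  (lam_partition : is_partition n lam)
  (lam_occurs : occurs_in (specht n lam) (PfB_cohomology n k)) :
  (k <= n - nth 0 lam 0)%N.
Proof.
have le_mn : (nth 0 lam 0 <= n)%N.
  case/and3P: lam_partition => _ _ /eqP <-.
  by case: (lam) => //= a l; apply: leq_addr.
rewrite leq_subRL // leqNgt; apply/negP => lt_nm.
have [c c0 inv] := specht_row_invariant n lam.
have [f [f_inj f_eq]] := lam_occurs.
have [g [g_bij g_eq]] := known_presentation.
have /eqP[] : c != 0 := c0.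
apply: f_inj; apply: (bij_inj g_bij); rewrite !linear0.
have avg0 : \sum_(p in row_group n lam) sn_act p (g (f c)) = 0.
  have [a ->] := flat_monomial_span (g (f c)).
  under eq_bigr do rewrite sn_act_sum.
  rewrite exchange_big big1 // => t _.
  under eq_bigr do rewrite linearZ.
  rewrite -scaler_sumr (flat_monomial_sum_eq0 _ _ le_mn lt_nm) ?scaler0 //.
  by move=> i j im jm p; apply/row_groupMl/row_group_tperm.
(* By invariance of [c] the sum is [g (f c)] times the order of the row group, which is nonzero
   because the group contains 1. *)
move: avg0; under eq_bigr => p Rp do rewrite -g_eq -f_eq (inv p Rp).
rewrite sumr_const -scaler_nat => /eqP; rewrite scaler_eq0 pnatr_eq0.
case/orP=> [|/eqP //]; rewrite cards_eq0 => /eqP/setP/(_ 1%g).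
by rewrite !inE => /negbT/forallPn[i]; rewrite perm1 eqxx.
Qed.
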